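(* Let $L$ be a prime number, let $M,N\ge 1$ be integers and let $\mathbf{A}=(a_{ij})$ be an $M\times N$ matrix of filters $a_{ij}\in\mathbb{C}^L$. Assume $\max_{i,j}\|a_{ij}\|_0\le k$ where $$\frac{k}{L}\le \alpha(N) := \begin{cases}\frac{2}{N(N+2)} & N \text{ even},\\ \frac{2}{(N+1)^2} & N\text{ odd}.\end{cases}$$ Then, up to a global permutation, $\mathbf{A}$ uniquely minimises the $\ell^0$ pseudo-norm among all its frequency permutations: for every $L$-tuple $(\sigma_0,\dots,\sigma_{L-1})$ of permutations of $\{1,\dots,N\}$, the resulting matrix $\tilde{\mathbf{A}}$ satisfies $\|\tilde{\mathbf{A}}\|_0\ge\|\mathbf{A}\|_0$, with equality only if $\tilde{\mathbf{A}}\equiv\mathbf{A}$.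
   Context: A filter is a vector $u\in\mathbb{C}^L$, $\|u\|_0=\#\{0\le t<L: u[t]\neq0\}$, and $\|\mathbf{A}\|_0=\sum_{i,j}\|a_{ij}\|_0$. $\mathbf{F}$ is the discrete Fourier transform on $\mathbb{C}^L$. Given permutations $\sigma_0,\dots,\sigma_{L-1}$ of $\{1,\dots,N\}$, the frequency-permuted matrix $\tilde{\mathbf{A}}=(\tilde a_{ij})$ is defined by $(\mathbf{F}\tilde a_{ij})[\omega]=(\mathbf{F}a_{i\sigma_\omega(j)})[\omega]$ for $0\le\omega<L$. We write $\tilde{\mathbf{A}}\equiv\mathbf{A}$ if there is a permutation $\pi$ of $\{1,\dots,N\}$ with $\tilde a_{ij}=a_{i\pi(j)}$ for all $i,j$. *)

(* Defs.v *)
From HB Require Import structures.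
From mathcomp Require Import all_boot all_order all_algebra all_fingroup.
From mathcomp Require Import complex.
From mathcomp Require Import reals trigo.

Set Implicit Arguments.
Unset Strict Implicit.
Unset Printing Implicit Defensive.

Import Order.TTheory GRing.Theory Num.Theory.
Local Open Scope ring_scope.
Local Open Scope complex_scope.

Definition cfilter (R : realType) (L : nat) : Type := 'rV[R[i]]_L.

Definition expi (R : realType) (x : R) : R[i] := cos x +i* sin x.

(* Unnormalised transform: (F u)[w] = \sum_t u[t] exp (- 2 pi i w t / L). *)
Definition dft (R : realType) (L : nat) (u : cfilter R L) : cfilter R L :=
  \row_(w < L) \sum_(t < L) u 0 t * expi (- (2 * pi * (w * t)%:R / L%:R)).

Definition l0 (R : realType) (L : nat) (u : cfilter R L) : nat :=
  #|[set t : 'I_L | u 0 t != 0]|.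

Definition l0mx (R : realType) (L M N : nat) (A : 'M[cfilter R L]_(M, N)) : nat :=
  (\sum_(i < M) \sum_(j < N) l0 (A i j))%N.

(* As dft is bijective for 0 < L, this determines tA from A and sigma. *)
Definition freq_permuted (R : realType) (L M N : nat) (sigma : 'I_L -> 'S_N)
    (A tA : 'M[cfilter R L]_(M, N)) : Prop :=
  forall (i : 'I_M) (j : 'I_N) (w : 'I_L),
    dft (tA i j) 0 w = dft (A i (sigma w j)) 0 w.

Definition perm_equiv (R : realType) (L M N : nat)
    (tA A : 'M[cfilter R L]_(M, N)) : Prop :=
  exists p : 'S_N, forall (i : 'I_M) (j : 'I_N), tA i j = A i (p j).

Definition alpha (N : nat) : rat :=
  if odd N then 2 / ((N + 1) ^ 2)%:R else 2 / (N * (N + 2))%:R.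

(* Main.v *)
(* Write c j n for the number of frequencies w with sigma w j = n; all row and
   column sums of c equal L. By Hall's theorem (Marcus-Ree), there is a diagonal
   p with c j (p j) >= 2k for all j: otherwise some s x t block with s + t = N + 1
   has all entries below 2k although its sum is at least L, contradicting
   2k * s * t <= L, which is what the bound k / L <= alpha N provides.
   The difference tA i j - A i (p j) then has a transform vanishing at 2k or more
   frequencies, so by the uncertainty principle for prime L it is either 0 or has
   more than 2k nonzero entries, and in the latter case l0 (tA i j) > k.

   The uncertainty principle is the nonvanishing of all minors of the Fourier
   matrix (Chebotarev). Newton interpolation at the points 'X^(w i) of
   {poly int} factors det ('X^(w i * t j)) into a product of differences of the
   points and the determinant Q of a matrix of divided differences. At 'X := zeta
   the product is nonzero, and Q(zeta) = 0 would force Q(1) = 0 mod L; but Q(1) is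
   the determinant of the binomial coefficients 'C(t j, k), nonzero mod L. *)

Require Import Defs.
From HB Require Import structures.
From mathcomp Require Import all_boot all_order all_algebra all_fingroup.
From mathcomp Require Import complex.
From mathcomp Require Import reals trigo.
From mathcomp Require Import zify ring lra.

Set Implicit Arguments.
Unset Strict Implicit.
Unset Printing Implicit Defensive.

Import Order.TTheory GRing.Theory Num.Theory.
Local Open Scope ring_scope.

(** * Integer polynomials at roots of unity, modulo a prime *)

(* The primitive part of gcd ('X^p - 1, q) divides both polynomials over int, and
   modulo p it is a nonconstant divisor of 'X^p - 1 = ('X - 1)^p, so it vanishes at 1. *)
Lemma root_unity_root_modp (p : nat) (C : numFieldType) (z : C) (q : {poly int}) :
  prime p -> z ^+ p = 1 -> root (map_poly intr q) z ->
  (q.[1])%:~R = 0 :> 'F_p.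
Proof.
move=> pp zp rz; have p_gt0 := prime_gt0 pp.
have [sq|sq] := leqP (size q) 1.
  move: rz; rewrite (size1_polyC sq) map_polyC rootE /= hornerC intr_eq0 => /eqP->.
  by rewrite hornerC.
pose P : {poly int} := 'X^p - 1.
have mP : P \is monic by rewrite /P -polyC1 monicXnsubC.
have sP : (1 < size P)%N by rewrite /P -polyC1 size_XnsubC.
(* Evaluating the Bezout identity for the resultant at the common root [z] shows that it is 0, so
   [P] and [q] have a nonconstant gcd. *)
have [[u v] _] := resultant_in_ideal sP sq; rewrite /= => E.
have r0 : resultant P q = 0.
  apply/eqP; rewrite -(intr_eq0 C); apply/eqP.
  have := congr1 (fun s => (map_poly intr s : {poly C}).[z]) E.
  rewrite map_polyC hornerC rmorphD !rmorphM hornerD !hornerM /= => ->.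
  rewrite (rootP rz) mulr0 addr0 rmorphB /= map_polyXn rmorph1 !hornerE.
  by rewrite zp subrr mulr0.
have : (1 < size (gcdp P q))%N by rewrite -resultant_eq0 r0.
set d := gcdp P q => sd.
have /dvdpP_int[a Pa] : d %| P by rewrite dvdp_gcdl.
have /dvdpP_int[b qb] : d %| q by rewrite dvdp_gcdr.
set e := zprimitive d in Pa qb.
have se : (1 < size e)%N by rewrite size_zprimitive.
pose f := map_poly (intr : int -> 'F_p).
have fP : f P = ('X - 1) ^+ p.
  have pc : p \in [pchar {poly 'F_p}] by rewrite pchar_poly pchar_Fp.
  rewrite /f rmorphB /= map_polyXn rmorph1.
  by rewrite -[RHS](pFrobenius_autE pc) pFrobenius_autB_comm ?pFrobenius_autE ?expr1n //; apply: commr1.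
(* The leading coefficient of [e] divides that of the monic [P], so reduction modulo [p] keeps the
   degree. *)
have sfe : (1 < size (f e))%N.
  have /eqP := congr1 lead_coef Pa.
  rewrite (monicP mP) lead_coefM eq_sym => /eqP /(congr1 (intr : int -> 'F_p)).
  rewrite rmorphM /= => /eqP; rewrite rmorph1 => /eqP H.
  rewrite /f size_map_poly_id0 //.
  by apply/eqP => h0; move/eqP: H; rewrite h0 mul0r eq_sym oner_eq0.
have re : root (f e) 1.
  apply/negPn/negP => nr.
  have : coprimep (f e) (f P).
    by rewrite fP coprimep_expr // -polyC1 coprimep_XsubC.
  rewrite Pa /f rmorphM /= coprimepMr => /andP[+ _].
  by rewrite coprimepp => /eqP H; move: sfe; rewrite /f H.
have : root (f q) 1 by rewrite qb /f rmorphM rootM re.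
by move/rootP; rewrite -[X in _.[X]](rmorph1 (intr : int -> 'F_p)) horner_map.
Qed.

(** * Newton interpolation and divided differences *)

(* Complete homogeneous symmetric polynomial of degree [t - k] in [x 0, ..., x k],
   i.e. the divided difference of ['X^t] at these points. *)
Fixpoint divdiff (R : comNzRingType) (x : nat -> R) (k t : nat) : R :=
  if t is t'.+1 then
    x k * divdiff x k t' + (if k is k'.+1 then divdiff x k' t' else 0)
  else (k == 0)%:R.

Definition newton (R : comNzRingType) (x : nat -> R) (k : nat) (y : R) : R :=
  \prod_(l < k) (y - x l).

(** Induction on [t]: writing [x i] as [x k + (x i - x k)] turns multiplication by [x i] into the
    recurrence of [divdiff]; the overflow term [newton x n (x i)] vanishes because [i < n]. *)
Lemma newton_interpolation (R : comNzRingType) (x : nat -> R) (n i t : nat) :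
  (i < n)%N -> x i ^+ t = \sum_(k < n) newton x k (x i) * divdiff x k t.
Proof.
move=> lin; elim: t => [|t IHt].
  case: n lin => // n _; rewrite big_ord_recl /= /newton big_ord0 mulr1 expr0.
  by rewrite big1 ?addr0 // => k _; rewrite mulr0.
have N0 : newton x n (x i) = 0.
  by rewrite /newton (bigD1 (Ordinal lin)) //= subrr mul0r.
have E k : x i * newton x k (x i) = x k * newton x k (x i) + newton x k.+1 (x i).
  by rewrite [newton _ k.+1 _]/newton big_ord_recr /= -/(newton x k _); ring.
rewrite exprS IHt mulr_sumr.
under eq_bigr => k _ do rewrite mulrA E mulrDl.
under [RHS]eq_bigr => k _ do rewrite /= mulrDr.
rewrite !big_split /=; congr (_ + _).
  by apply: eq_bigr => k _; rewrite mulrCA mulrA.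
case: n lin N0 {IHt} => // n _ N0.
by rewrite big_ord_recr /= N0 mul0r addr0 big_ord_recl /= mulr0 add0r.
Qed.

Lemma rmorph_divdiff (R S : comNzRingType) (f : {rmorphism R -> S}) (x : nat -> R) k t :
  f (divdiff x k t) = divdiff (f \o x) k t.
Proof.
elim: t k => [|t IHt] k /=; first by rewrite rmorph_nat.
by rewrite rmorphD rmorphM IHt; case: k => [|k] /=; rewrite ?rmorph0 ?IHt.
Qed.

(** At points all equal to 1 the recurrence becomes Pascal's rule. *)
Lemma divdiff1 (R : comNzRingType) (x : nat -> R) k t :
  (forall i, x i = 1) -> divdiff x k t = 'C(t, k)%:R.
Proof.
move=> x1; elim: t k => [|t IHt] k /=; first by case: k.
by rewrite x1 mul1r IHt; case: k => [|k]; rewrite ?bin0 ?addr0 // binS natrD IHt.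
Qed.

(** Interpolation factors the matrix, and the Newton factor is lower triangular: [newton x k (x i)]
    contains the factor [x i - x i] when [i < k]. *)
Lemma det_powers (R : comNzRingType) (n : nat) (x : nat -> R) (s : 'I_n -> nat) :
  \det (\matrix_(i < n, j < n) x i ^+ s j) =
  (\prod_(i < n) newton x i (x i)) * \det (\matrix_(k < n, j < n) divdiff x k (s j)).
Proof.
pose T := \matrix_(i < n, k < n) newton x k (x i).
have -> : \matrix_(i < n, j < n) x i ^+ s j =
    T *m \matrix_(k < n, j < n) divdiff x k (s j).
  apply/matrixP=> i j; rewrite !mxE (newton_interpolation x (s j) (ltn_ord i)).
  by apply: eq_bigr => k _; rewrite !mxE.
rewrite det_mulmx det_trig; first by congr (_ * _); apply: eq_bigr => i _; rewrite mxE.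
apply/is_trig_mxP => i j lij; rewrite mxE /newton.
by rewrite (bigD1 (Ordinal lij)) //= subrr mul0r.
Qed.

(** * Minors of the Fourier matrix *)

(** A left kernel vector [v] yields a polynomial of degree below [n] with [n] distinct roots [s j]
    modulo [p], hence the zero polynomial. *)
Lemma det_binomial_modp (p n : nat) (s : 'I_n -> nat) :
  prime p -> injective s -> (forall j, s j < p)%N ->
  \det (\matrix_(k < n, j < n) 'C(s j, k)%:R) != 0 :> 'F_p.
Proof.
move=> pp sI sp; apply/negP => /det0P[v nv /matrixP vM].
have np : (n <= p)%N.
  have := @leq_card _ _ (fun j => Ordinal (sp j)) _.
  by rewrite !card_ord; apply => i j [/sI].
have fact0 k : (k < p)%N -> k`!%:R != 0 :> 'F_p.
  elim: k => [|k IHk] kp; first by rewrite oner_eq0.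
  rewrite factS natrM mulf_neq0 ?IHk ?(ltnW kp) //.
  by rewrite -(dvdn_pcharf (pchar_Fp pp)) gtnNdvd.
(* [b k] is the polynomial binomial coefficient "X choose k". *)
pose b k : {poly 'F_p} := (k`!%:R)^-1 *: \prod_(l < k) ('X - (l : nat)%:R%:P).
have bE (k : 'I_n) m : (b k).[m%:R] = 'C(m, k)%:R.
  have kp : (k < p)%N by apply: leq_trans (ltn_ord k) np.
  apply: (mulfI (fact0 _ kp)); rewrite hornerZ mulVKf ?fact0 // -natrM mulnC bin_ffact.
  elim: (k : nat) => [|j IHj]; first by rewrite big_ord0 hornerC.
  rewrite big_ord_recr /= hornerM IHj hornerXsubC ffactnSr natrM.
  have [jm|mj] := leqP j m; first by rewrite natrB.
  by rewrite ffact_small // !mul0r.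
pose g := \sum_(k < n) v 0 k *: b k.
have gE m : g.[m%:R] = \sum_(k < n) v 0 k * 'C(m, k)%:R.
  by rewrite horner_sum; apply: eq_bigr => k _; rewrite hornerZ bE.
have g0 : g = 0.
  apply/eqP; apply: contraT => gn.
  pose rs := [seq (s j)%:R : 'F_p | j <- enum 'I_n].
  have rg : all (root g) rs.
    apply/allP => _ /mapP[j _ ->]; rewrite rootE gE.
    by have := vM 0 j; rewrite !mxE => {2}<-; apply/eqP/eq_bigr => k _; rewrite mxE.
  have rsU : uniq rs.
    rewrite map_inj_uniq ?enum_uniq // => i j /(congr1 val) /=.
    by rewrite !val_Fp_nat // !modn_small // => /sI.
  have := max_poly_roots gn rg rsU; rewrite size_map size_enum_ord ltnNge.
  case/negP; apply: leq_trans (size_sum _ _ _) _; apply/bigmax_leqP => k _.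
  apply: leq_trans (size_scale_leq _ _) _; apply: leq_trans (size_scale_leq _ _) _.
  by rewrite size_prod_XsubC -[index_enum _]enumT size_enum_ord.
case/negP: nv; apply/eqP/rowP => i; rewrite mxE.
(* Evaluating [g = 0] at 0, 1, 2, ... kills the coefficients one by one, since ['C(i, k)] is 0 for
   [k > i]. *)
have [m] := ubnP (i : nat); elim: m i => // m IHm i im.
have := gE i; rewrite g0 horner0 (bigD1 i) //= binn mulr1 big1 ?addr0 // => k ki.
have [lki|lik] := ltnP k i; first by rewrite IHm ?mul0r //; lia.
by rewrite bin_small ?mulr0 // ltn_neqAle lik andbT eq_sym.
Qed.

Lemma chebotarev_minor (C : numFieldType) (p n : nat) (z : C) (w t : 'I_n -> nat) :
  prime p -> p.-primitive_root z ->
  injective w -> (forall i, w i < p)%N -> injective t -> (forall j, t j < p)%N ->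
  \det (\matrix_(i < n, j < n) z ^+ (w i * t j)) != 0.
Proof.
move=> pp zp wI wp tI tp.
(* [divdiff] takes points indexed by [nat], so [w] is extended by 0 outside ['I_n]. *)
pose x i : {poly int} := 'X^(oapp w 0%N (insub i)).
have xE (i : 'I_n) : x i = 'X^(w i) by rewrite /x valK.
pose Q := \det (\matrix_(k < n, j < n) divdiff x k (t j)).
pose phi : {rmorphism {poly int} -> C} := horner_eval z \o map_poly intr.
have phix (i : 'I_n) : phi (x i) = z ^+ w i.
  by rewrite xE /phi /= map_polyXn /horner_eval hornerXn.
have -> : \det (\matrix_(i < n, j < n) z ^+ (w i * t j)) =
    phi (\prod_(i < n) newton x i (x i)) * phi Q.
  rewrite -rmorphM -det_powers -det_map_mx; congr (\det _).
  by apply/matrixP => i j; rewrite !mxE rmorphXn phix exprM.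
rewrite mulf_neq0 //.
  rewrite rmorph_prod; apply/prodf_neq0 => i _.
  rewrite /newton rmorph_prod; apply/prodf_neq0 => l _.
  have ln : (l < n)%N by apply: ltn_trans (ltn_ord l) (ltn_ord i).
  rewrite rmorphB phix (phix (Ordinal ln)) subr_eq0.
  rewrite (eq_prim_root_expr zp) !modn_small //; apply/eqP => /wI/(congr1 val)/eqP /=.
  by rewrite gtn_eqF.
apply/negP => Q0.
have := root_unity_root_modp pp (prim_expr_order zp) Q0.
pose psi : {rmorphism {poly int} -> 'F_p} := intr \o horner_eval 1.
rewrite -[_%:~R]/(psi Q) -det_map_mx => /eqP; apply/negP.
rewrite (_ : map_mx _ _ = \matrix_(k < n, j < n) 'C(t j, k)%:R).
  exact: det_binomial_modp.
apply/matrixP => k j; rewrite !mxE rmorph_divdiff divdiff1 // => i.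
by rewrite /psi /= /horner_eval hornerXn expr1n.
Qed.

(** * Fourier transform and uncertainty principle *)

Lemma expi0 (R : realType) : expi 0 = 1 :> R[i].
Proof. by rewrite /expi cos0 sin0. Qed.

Lemma expiD (R : realType) (x y : R) : expi (x + y) = expi x * expi y.
Proof. by rewrite /expi cosD sinD; apply/eqP; rewrite eq_complex /= eqxx addrC mulrC eqxx. Qed.

Lemma expi_mulrn (R : realType) (x : R) n : expi (x *+ n) = expi x ^+ n.
Proof.
elim: n => [|n IHn]; first by rewrite mulr0n expi0.
by rewrite mulrS expiD IHn exprS.
Qed.

Definition root_unity (R : realType) (L : nat) : R[i] := expi (- (2 * pi / L%:R)).

Lemma dftE (R : realType) (L : nat) (u : cfilter R L) w :
  dft u 0 w = \sum_(t < L) u 0 t * root_unity R L ^+ (w * t).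
Proof.
rewrite mxE; apply: eq_bigr => t _; congr (_ * _).
by rewrite /root_unity -expi_mulrn mulNrn mulrAC mulr_natr.
Qed.

Lemma root_unity_prim (R : realType) (L : nat) :
  prime L -> L.-primitive_root (root_unity R L).
Proof.
move=> pL; have L0 : L%:R != 0 :> R by rewrite pnatr_eq0 -lt0n prime_gt0.
have zL : root_unity R L ^+ L = 1.
  rewrite /root_unity -expi_mulrn mulNrn -[X in - X]mulr_natr divfK // mulr_natl.
  by rewrite /expi cosN sinN cos2pi sin2pi oppr0.
have z1 : root_unity R L != 1.
  have L2 : 2 <= L%:R :> R by rewrite ler_nat prime_gt1.
  have Lp : 0 < L%:R :> R by lra.
  have p0 := pi_gt0 R.
  apply/negP => /eqP /(congr1 (@complex.Re R)) /=; rewrite cosN -[RHS]cos0 => H.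
  (* [cos] is injective on [0, pi], which contains [2 * pi / L] because [L >= 2]. *)
  have : 2 * pi / L%:R = 0 :> R.
    apply: cos_inj H; rewrite in_itv /= ?lexx ?pi_ge0 // divr_ge0 ?mulr_ge0 ?pi_ge0 ?ler0n //=.
    by rewrite ler_pdivrMr // mulrC ler_pM2l.
  by move/eqP; rewrite mulf_eq0 invr_eq0 (negPf L0) orbF mulf_eq0 pnatr_eq0 /= gt_eqF.
have [m zm mL] := prim_order_exists (prime_gt0 pL) zL.
move: (primeP pL) => [_ /(_ _ mL) /orP[] /eqP mE]; last by rewrite mE in zm.
by move: z1; rewrite -(prim_expr_order zm) mE expr1 eqxx.
Qed.

(** Keeping as many rows of [W] as the support of [u] has elements gives an invertible square minor
    that kills the restriction of [u] to its support. *)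
Lemma uncertainty (R : realType) (L : nat) (u : cfilter R L) (W : {set 'I_L}) :
  prime L -> {in W, forall w, dft u 0 w = 0} -> (l0 u <= #|W|)%N -> u = 0.
Proof.
move=> pL uW; rewrite /l0; set S := [set t | _] => SW.
pose t (j : 'I_#|S|) : nat := enum_val j.
pose w (i : 'I_#|S|) : nat := enum_val (widen_ord SW i).
have tI : injective t by move=> i j /val_inj /enum_val_inj.
have wI : injective w by move=> i j /val_inj /enum_val_inj /(congr1 val) /= /val_inj.
have := chebotarev_minor pL (root_unity_prim R pL) wI (fun=> ltn_ord _) tI (fun=> ltn_ord _).
set E := \matrix_(i, j) _ => detE.
pose v : 'cV_#|S| := \col_j u 0 (enum_val j).
have Ev : E *m v = 0.
  apply/colP => i; rewrite !mxE.
  have := uW (enum_val (widen_ord SW i)) (enum_valP _).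
  rewrite dftE (bigID (mem S)) /= [X in _ + X]big1 ?addr0.
    rewrite big_enum_val /= => {2}<-; apply: eq_bigr => j _.
    by rewrite !mxE mulrC.
  by move=> s; rewrite inE negbK => /eqP->; rewrite mul0r.
have v0 : v = 0 by rewrite -[v](mulKmx (_ : E \in unitmx)) ?Ev ?mulmx0 // unitmxE unitfE.
apply/rowP => s; rewrite mxE; apply/eqP/negPn/negP => us.
have sS : s \in S by rewrite inE.
have := congr1 (fun a : 'cV_#|S| => a (enum_rank_in sS s) 0) v0.
by rewrite !mxE enum_rankK_in // => /eqP; apply/negP.
Qed.

Lemma dftB (R : realType) (L : nat) (u v : cfilter R L) w :
  dft (u - v) 0 w = dft u 0 w - dft v 0 w.
Proof.
by rewrite !mxE -sumrB; apply: eq_bigr => t _; rewrite !mxE mulrBl.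
Qed.

Lemma l0B (R : realType) (L : nat) (u v : cfilter R L) :
  (l0 (u - v)%R <= l0 u + l0 v)%N.
Proof.
apply: leq_trans (leq_card_setU _ _); apply/subset_leq_card/subsetP => t.
rewrite !inE !mxE; have [->|//] := eqVneq (u 0 t) 0.
by rewrite sub0r oppr_eq0.
Qed.

(** * Hall's theorem and large diagonals *)

Lemma hall_marriage (T U : finType) (u0 : U) (e : T -> {set U}) (A : {set T}) :
  (forall S : {set T}, S \subset A -> #|S| <= #|\bigcup_(x in S) e x|)%N ->
  exists f : T -> U, {in A &, injective f} /\ {in A, forall x, f x \in e x}.
Proof.
have [m] := ubnP #|A|; elim: m e A => // m IHm e A /ltnSE cA hallA.
have [->|[x xA]] := set_0Vmem A.
  by exists (fun=> u0); split=> x; rewrite ?inE.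
(* A tight proper subset [S] is matched inside its neighbourhood [E], and the rest of [A] outside
   [E]; tightness cancels [S] from Hall's condition for [B :|: S]. *)
have [/existsP[S /and3P[SA S0 /eqP tS]]|] := boolP [exists S : {set T},
    [&& S \proper A, S != set0 & #|\bigcup_(x in S) e x| == #|S|]].
  have sSA := proper_sub SA.
  have [||f [fI fe]] := IHm e S.
  - exact: leq_trans (proper_card SA) cA.
  - by move=> B BS; apply: hallA; apply: subset_trans BS sSA.
  set E := \bigcup_(x in S) e x in tS.
  have [||g [gI ge]] := IHm (fun z => e z :\: E) (A :\: S).
  - apply: leq_trans cA; rewrite cardsD (setIidPr sSA).
    have := subset_leq_card sSA; rewrite -card_gt0 in S0; lia.
  - move=> B BA.
    have dBS : [disjoint B & S].
      by move: BA; rewrite subsetD => /andP[].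
    have BSA : B :|: S \subset A.
      by rewrite subUset sSA andbT (subset_trans BA) ?subsetDl.
    have := hallA _ BSA; rewrite cardsU (eqP (_ : B :&: S == set0)) ?setI_eq0 //.
    rewrite cards0 subn0 bigcup_setU -/E.
    have -> : (\bigcup_(z in B) e z) :|: E = (\bigcup_(z in B) (e z :\: E)) :|: E.
      apply/setP=> y; rewrite !in_setU; have [yE|yE] := boolP (y \in E); rewrite ?orbT ?orbF //.
      by apply/bigcupP/bigcupP => -[z zB]; rewrite ?inE ?yE => yz; exists z; rewrite // inE yE.
    move=> H; have := leq_trans H (leq_card_setU _ _); lia.
  exists (fun z => if z \in S then f z else g z); split=> [y z yA zA|z zA] /=.
    have fE w : w \in S -> f w \in E by move=> wS; apply/bigcupP; exists w => //; apply: fe.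
    have gE w : w \in A -> w \notin S -> g w \notin E.
      by move=> wA wS; have := ge w; rewrite !inE wS => /(_ wA) /andP[].
    case: ifP => yS; case: ifP => zS.
    - exact: fI.
    - by move=> H; have := fE _ yS; rewrite H (negPf (gE _ zA (negbT zS))).
    - by move=> H; have := fE _ zS; rewrite -H (negPf (gE _ yA (negbT yS))).
    - by apply: gI; rewrite inE ?yS ?zS.
  case: ifP => zS; first exact: fe.
  by have := ge z; rewrite !inE zS => /(_ zA) /andP[].
(* Without tight subsets each nonempty proper one has a spare neighbour, so [x] may take any [y] in
   [e x]. *)
rewrite negb_exists => /forallP nt.
have strict (S : {set T}) : S \proper A -> S != set0 ->
    (#|S| < #|\bigcup_(z in S) e z|)%N.
  move=> SA S0; have := nt S; rewrite SA S0 /= => neq.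
  by rewrite ltn_neqAle eq_sym neq hallA ?proper_sub.
have /card_gt0P[y yx] : (0 < #|e x|)%N.
  by have := hallA [set x]; rewrite sub1set cards1 big_set1 => /(_ xA).
have [||g [gI ge]] := IHm (fun z => e z :\ y) (A :\ x).
- by move: cA; rewrite (cardsD1 x A) xA.
- move=> B BA; have [->|B0] := eqVneq B set0; first by rewrite cards0.
  have BpA : B \proper A.
    apply/properP; split; first by apply: subset_trans BA _; apply: subD1set.
    by exists x => //; apply/negP => /(subsetP BA); rewrite !inE eqxx.
  have := strict B BpA B0.
  have -> : \bigcup_(z in B) (e z :\ y) = (\bigcup_(z in B) e z) :\ y.
    apply/setP=> w; rewrite !inE; have [->|wy] /= := eqVneq w y.
      by apply/negbTE/negP => /bigcupP[z _]; rewrite !inE eqxx.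
    by apply/bigcupP/bigcupP => -[z zB]; rewrite ?inE ?wy => yz; exists z; rewrite // !inE wy.
  rewrite (cardsD1 y (\bigcup_(z in B) e z)); case: (_ \in _) => /=; lia.
exists (fun z => if z == x then y else g z); split=> [w z wA zA|z zA] /=.
  have gy v : v \in A -> v != x -> g v != y.
    by move=> vA vx; have := ge v; rewrite !inE vx => /(_ vA) /andP[].
  case: eqVneq => [->|wx]; case: eqVneq => [->|zx] //.
  - by move=> H; have := gy _ zA zx; rewrite -H eqxx.
  - by move=> H; have := gy _ wA wx; rewrite H eqxx.
  - by apply: gI; rewrite !inE ?wx ?zx.
case: eqVneq => [->|zx] //.
by have := ge z; rewrite !inE zx => /(_ zA) /andP[].
Qed.

(** If Hall's condition fails for the rows [S], the columns [E] absorb at most [m * L] of the total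
    [s * L]; the remaining block has sum at least [(s - m) * L], too much for entries at most
    [b.-1]. *)
Lemma doubly_stochastic_diagonal (N L b : nat) (c : 'I_N -> 'I_N -> nat) :
  (0 < L)%N -> (forall j, \sum_n c j n = L)%N -> (forall n, \sum_j c j n = L)%N ->
  (forall s t, s + t = N.+1 -> b * (s * t) <= L)%N ->
  exists p : 'S_N, forall j, (b <= c j (p j))%N.
Proof.
move=> L0 rowL colL bst.
case: N => [|N] in c rowL colL bst *; first by exists 1%g; case.
pose e j := [set n | b <= c j n]%N.
have [|f [fI fe]] := @hall_marriage _ _ ord0 e setT.
  move=> S _; rewrite leqNgt; apply/negP; set E := \bigcup_(j in S) e j => ES.
  have cE := cardsC E; have sN := max_card (mem S); rewrite !card_ord in cE sN.
  set s := #|S| in ES sN; set m := #|E| in ES cE; set T := ~: E in cE.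
  have upper : (\sum_(j in S) \sum_(n in T) c j n <= s * (#|T| * b.-1))%N.
    rewrite /s -sum_nat_const; apply: leq_sum => j jS.
    rewrite -sum_nat_const; apply: leq_sum => n.
    rewrite inE => nE; have : n \notin e j.
      by apply: contra nE => nj; apply/bigcupP; exists j.
    by rewrite inE -ltnNge; lia.
  have lower : (\sum_(j in S) \sum_(n in E) c j n <= m * L)%N.
    rewrite exchange_big /= /m -sum_nat_const; apply: leq_sum => n _.
    by rewrite -(colL n) [leqRHS](bigID (mem S)) leq_addr.
  have total : (s * L = \sum_(j in S) \sum_(n in E) c j n + \sum_(j in S) \sum_(n in T) c j n)%N.
    rewrite /s -sum_nat_const -big_split; apply: eq_bigr => j _ /=.
    rewrite -(rowL j) (bigID (mem E)) /=; congr (_ + _)%N.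
    by apply: eq_bigl => n; rewrite inE.
  (* The block may be wider than the [t1] columns to which [bst] applies: [d], defined as
     [s - m - 1], is also the number of extra columns. *)
  have [t1 Et] : exists t, (s + t = N.+2)%N by exists (N.+2 - s)%N; lia.
  have [d Ed] : exists d, (s = m + d.+1)%N by exists (s - m.+1)%N; lia.
  have T1 : (#|T| = t1 + d)%N by lia.
  have H1 := bst _ _ Et.
  have t1_gt0 : (0 < t1)%N by lia.
  have H2 : (b * s <= L)%N.
    by apply: leq_trans H1; rewrite mulnA leq_pmulr.
  have H3 : (d.+1 * L <= s * ((t1 + d) * b.-1))%N by nia.
  (* The first bound plus [z] times the second gives [b * (x * (y + z)) <= z.+1 * L], so the third,
     with [b.-1], forces both products to be 0, against [0 < L]. *)
  have key x y z : (b * (x * y) <= L)%N -> (b * x <= L)%N ->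
      (z.+1 * L <= x * ((y + z) * b.-1))%N -> False.
    case: {+}b => [|a] /=; first by rewrite !muln0; lia.
    move=> hxy hx hL.
    have hz : (z * (a.+1 * x) <= z * L)%N by rewrite leq_mul2l hx orbT.
    have xy0 : (x * y = 0)%N by lia.
    have xz0 : (x * z = 0)%N by lia.
    by move: hL; rewrite mulnA mulnDr xy0 xz0; lia.
  exact: key H1 H2 H3.
have fI' : injective f by move=> i j; apply: fI; rewrite inE.
by exists (perm fI') => j; rewrite permE; have := fe j; rewrite !inE; apply.
Qed.

(** * The sparsity bound and the minimisation *)

(** AM-GM bounds [4 * (s * t)] by [(N + 1) ^ 2]; for even [N] the sum [s + t] is odd, so [s] and [t]
    differ and the bound drops by one, to [N * (N + 2)]. *)
Lemma alpha_bound (N L k s t : nat) :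
  (0 < L)%N -> (0 < N)%N -> k%:R / L%:R <= alpha N -> (s + t = N.+1)%N ->
  (2 * k * (s * t) <= L)%N.
Proof.
move=> L0 N0; rewrite /alpha ler_pdivrMr ?ltr0n //.
have step (D : nat) : (0 < D)%N -> k%:R <= 2 / D%:R * L%:R :> rat -> (k * D <= 2 * L)%N.
  by move=> D0; rewrite mulrAC ler_pdivlMr ?ltr0n // -!natrM ler_nat.
have le4 D : (4 * (s * t) <= D)%N -> (k * D <= 2 * L)%N -> (2 * k * (s * t) <= L)%N.
  by move=> /(leq_mul (leqnn k)); lia.
case: ifP => oN /step H st; apply: le4 (H _); rewrite ?expn_gt0 ?muln_gt0 ?N0 ?addn1 ?addn2 //.
  by rewrite -st nat_AGM2.
have : (4 * (s * t) < (s + t) ^ 2)%N.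
  rewrite (ltn_leqif (nat_AGM2 s t)); apply/eqP => E.
  by move: oN st; rewrite E; lia.
by rewrite st -mulnn; lia.
Qed.

Theorem theorem2 (R : realType) (L M N k : nat)
    (hL : prime L) (hM : (1 <= M)%N) (hN : (1 <= N)%N)
    (A : 'M[cfilter R L]_(M, N))
    (hk : forall (i : 'I_M) (j : 'I_N), (l0 (A i j) <= k)%N)
    (hkL : k%:R / L%:R <= alpha N)
    (sigma : 'I_L -> 'S_N) (tA : 'M[cfilter R L]_(M, N))
    (htA : freq_permuted sigma A tA) :
  (l0mx A <= l0mx tA)%N /\ (l0mx tA = l0mx A -> perm_equiv tA A).
Proof.
have L0 := prime_gt0 hL.
pose c j n := #|[set w | sigma w j == n]|.
have [|n|s t st|p pc] := @doubly_stochastic_diagonal N L (2 * k) c L0.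
- move=> j; rewrite -[RHS]card_ord -sum1_card.
  rewrite (partition_big (fun w => sigma w j) xpredT) //=; apply: eq_bigr => n _.
  by rewrite sum1dep_card.
- rewrite -[RHS]card_ord -sum1_card.
  rewrite (partition_big (fun w => (sigma w)^-1%g n) xpredT) //=; apply: eq_bigr => j _.
  rewrite sum1dep_card; apply: eq_card => w; rewrite !inE.
  by apply/eqP/eqP => <-; rewrite ?permK ?permKV.
- exact: alpha_bound st.
(* The diagonal [p] comes from [sigma] and [k], so the same [p] serves every row [i]. *)
have dich i j : tA i j = A i (p j) \/ (l0 (A i (p j)) < l0 (tA i j))%N.
  have [le|lt] := leqP (l0 (tA i j)) (l0 (A i (p j))); last by right.
  left; apply/eqP; rewrite -subr_eq0; apply/eqP.
  apply: (@uncertainty _ _ _ [set w | sigma w j == p j]) => //.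
    by move=> w; rewrite inE => /eqP wj; rewrite dftB htA wj subrr.
  apply: leq_trans (pc j); apply: leq_trans (l0B _ _) _.
  by have := hk i (p j); lia.
have sumA : l0mx A = (\sum_(i < M) \sum_(j < N) l0 (A i (p j)))%N.
  by apply: eq_bigr => i _; rewrite (reindex_inj (@perm_inj _ p)).
have le i j : (l0 (A i (p j)) <= l0 (tA i j))%N by case: (dich i j) => [->|/ltnW].
split; first by rewrite sumA; apply: leq_sum => i _; apply: leq_sum => j _.
(* One strict entry would make the total strict, since no entry decreases. *)
move=> E; exists p => i j; case: (dich i j) => // lt.
suff : (\sum_(j < N) l0 (A i (p j)) < \sum_(j < N) l0 (tA i j))%N.
  move=> lti; suff : (\sum_(i < M) \sum_(j < N) l0 (A i (p j)) < l0mx tA)%N by rewrite -sumA -E ltnn.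
  rewrite /l0mx (bigD1 i) //= [ltnRHS](bigD1 i) //= -addSn leq_add // leq_sum // => i' _.
  by apply: leq_sum.
rewrite (bigD1 j) //= [ltnRHS](bigD1 j) //= -addSn leq_add //.
by apply: leq_sum.
Qed.
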